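(* Let $\mathcal{H}$ be a finite family of tournaments. If $\mathcal{H}$ has the $(\mathcal{F},v,\eta)$-strong EH-property, then it has the $(\mathcal{F},v,\eta)$-super-strong EH-property.
   Context: Tournaments are finite; a subtournament is an induced subtournament; transitive means no directed cycle; $tr(T)$ is the maximum size of a transitive subtournament of $T$. $V_1$ is complete to $V_2$ if every vertex of $V_1$ has an edge to every vertex of $V_2$. For disjoint nonempty $X,Y\subseteq V(T)$, $d(X,Y)=e_{X,Y}/(|X||Y|)$ with $e_{X,Y}$ the number of edges $(x,y)$, $x\in X,y\in Y$. For a $\{0,1\}$-vector $v$ of length $m$, $\zeta^v(i)=|\{j\le i:v(j)=1\}|$; $\eta$ is a vector of positive integers of length $\zeta^v(m)$; $k=|\{j:v(j)=0\}|+\sum_i\eta(i)$. For a tournament $T$, $c>0$, $0\le\lambda<1$, a $(v,\eta,c,\lambda)$-m-sequence in $T$ is a sequence $\chi=(S_1,\dots,S_m)$ of pairwise disjoint subsets of $V(T)$ such that: if $v(i)=1$, $S_i$ induces a transitive subtournament and is partitioned into $S_{i,1},\dots,S_{i,\eta(\zeta^v(i))}$ with $S_{i,a}$ complete to $S_{i,b}$ for $a<b$ and each $|S_{i,a}|\ge c\,tr(T)$; if $v(i)=0$, $|S_i|\ge c|T|$; and $d(S_i,S_j)\ge1-\lambda$ for $i<j$. Its long representation $l(\chi)=(T_1,\dots,T_k)$ replaces each $S_i$ with $v(i)=1$ by $S_{i,1},\dots,S_{i,\eta(\zeta^v(i))}$ in order; $V(\chi)=\bigcup S_i$. A $c'$-strong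 pair in $\chi$ is a pair $(A,B)$ of disjoint subsets of $V(\chi)$ with $|A|\ge c'|T|$, either $|B|\ge c'|T|$ or ($B$ transitive and $|B|\ge c'\,tr(T)$), and $d(A,B)=1$ or $d(B,A)=1$. Let $\mathcal{H}=\{H_1,\dots,H_t\}$, $V(H_i)=\{h^i_1,\dots,h^i_{|H_i|}\}$, $\mathcal{F}=\{f_1,\dots,f_t\}$ with $f_i:V(H_i)\to\{1,\dots,k\}$ injective. $\mathcal{H}$ has the $(\mathcal{F},v,\eta)$-strong EH-property if for every $c_1>0$ there exist $\lambda_0>0,c_2>0$ such that for every tournament $T$, $0\le\lambda\le\lambda_0$ and $(v,\eta,c_1,\lambda)$-m-sequence $\chi$ in $T$ with $l(\chi)=(T_1,\dots,T_k)$, either there are $i$ and $x_j\in T_{f_i(h^i_j)}$ ($1\le j\le |H_i|$) such that $x_j\mapsto h^i_j$ is an isomorphism from the subtournament induced on $\{x_j\}$ onto $H_i$, or $\chi$ contains a $c_2$-strong pair. For a tournament $H$ with $V(H)=\{h_1,\dots,h_n\}$, $f:V(H)\to\{1,\dots,k\}$ and $\mu>0$, $H$ is $(f,\mu)$-well-embedded in $\chi$ (with $l(\chi)=(T_1,\dots,T_k)$) if there exist $x_1,\dots,x_n$ with $x_j\in T_{f(h_j)}$ such that $x_j\mapsto h_j$ is an isomorphism from the subtournament induced on $\{x_1,\dots,x_n\}$ onto $H$, and for every index $i$ such that no $x_j$ lies in $T_i$ and every $j$: $d(\{x_j\},T_i)\ge1-\mu$ if $f(h_j)<i$, and $d(T_i,\{x_j\})\ge1-\mu$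 if $f(h_j)>i$. $\mathcal{H}$ has the $(\mathcal{F},v,\eta)$-super-strong EH-property if for every $c_1>0$ there exist $\lambda_0>0,c_2>0$ such that for every tournament $T$, $0\le\lambda\le\lambda_0$ and $(v,\eta,c_1,\lambda)$-m-sequence $\chi$ in $T$, either some $H_i$ is $(f_i,\frac1{2k})$-well-embedded in $\chi$, or $\chi$ contains a $c_2$-strong pair. *)

(* Defs.v *)
From mathcomp Require Import all_boot all_order all_algebra.
From mathcomp Require Import boolp reals.

Set Implicit Arguments.
Unset Strict Implicit.
Unset Printing Implicit Defensive.

Import Order.TTheory GRing.Theory Num.Theory.

Local Open Scope ring_scope.

Record tournament := Tournament {
  vertex :> finType;
  arc : rel vertex;
  arc_irr : irreflexive arc;
  arc_total : forall x y, x != y -> arc x y = ~~ arc y x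
}.

Section Tournaments.

Context {T : tournament}.
Implicit Types (X Y : {set T}).

(* [ucycle] holds of the empty sequence, which is not a directed cycle. *)
Definition transitive_set X : Prop :=
  forall p : seq T, p != [::] -> {subset p <= X} -> ~ ucycle (arc (t := T)) p.

Definition complete_to X Y : Prop := {in X & Y, forall x y, arc x y}.

Definition arcs_between X Y : nat :=
  #|[set p in setX X Y | arc p.1 p.2]|.

(* Only meaningful for nonempty [X] and [Y]; otherwise the value is 0. *)
Definition density (R : realType) X Y : R :=
  (arcs_between X Y)%:R / (#|X| * #|Y|)%:R.

End Tournaments.

Definition tr (T : tournament) : nat :=
  \max_(X : {set T} | `[< transitive_set X >]) #|X|.

(* The number of ones among the first [i] entries of [v]. *)
Definition zeta (m : nat) (v : m.-tuple bool) (i : nat) : nat :=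
  #|[set j : 'I_m | (j < i)%N && tnth v j]|.

(* Indices are counted from 0: entry [i] of [v] is the [i.+1]-st one, and
   position [z] of the vector [eta] is [nth 0 eta z.-1]. *)
Definition eta_at (m : nat) (v : m.-tuple bool) (eta : seq nat) (i : 'I_m) :
    nat :=
  nth 0%N eta (zeta v i.+1).-1.

Definition long_length (m : nat) (v : m.-tuple bool) (eta : seq nat) : nat :=
  (#|[set j : 'I_m | ~~ tnth v j]| + sumn eta)%N.

(* The partition of each [S_i] with [v(i) = 1] is part of the data of an
   m-sequence, since the long representation depends on it; [mparts chi i] is
   irrelevant when [v(i) = 0]. *)
Record mseq (T : tournament) (m : nat) := MSeq {
  mset : 'I_m -> {set T};
  mparts : 'I_m -> seq {set T}
}.

Section MSequences.

Variables (R : realType) (T : tournament) (m : nat).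
Variables (v : m.-tuple bool) (eta : seq nat).
Implicit Types (chi : mseq T m).

Definition is_mseq (c lambda : R) chi : Prop :=
  [/\ 0 < c,
      0 <= lambda < 1,
      (forall i j : 'I_m, i != j -> [disjoint mset chi i & mset chi j]),
      (forall i : 'I_m,
        if tnth v i then
          [/\ transitive_set (mset chi i),
              size (mparts chi i) = eta_at v eta i,
              \bigcup_(X <- mparts chi i) X = mset chi i,
              (forall a b : nat, (a < b < size (mparts chi i))%N ->
                 [disjoint nth set0 (mparts chi i) a
                         & nth set0 (mparts chi i) b] /\
                 complete_to (nth set0 (mparts chi i) a)
                             (nth set0 (mparts chi i) b)) &
              (forall X : {set T}, X \in mparts chi i ->
                 c * (tr T)%:R <= #|X|%:R)]
        else c * #|T|%:R <= #|mset chi i|%:R) &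
      (forall i j : 'I_m, (i < j)%N ->
         1 - lambda <= density R (mset chi i) (mset chi j))].

Definition mvertices chi : {set T} := \bigcup_(i < m) mset chi i.

Definition long_rep chi : seq {set T} :=
  flatten [seq if tnth v i then mparts chi i else [:: mset chi i]
          | i <- enum 'I_m].

(* When [is_mseq] holds and [size eta = zeta v m], the list [long_rep chi] has
   length [long_length v eta], so the default [set0] is never reached. *)
Definition long_set chi (j : 'I_(long_length v eta)) : {set T} :=
  nth set0 (long_rep chi) j.

Definition strong_pair (c' : R) chi (A B : {set T}) : Prop :=
  [/\ [&& A \subset mvertices chi, B \subset mvertices chi & [disjoint A & B]],
      c' * #|T|%:R <= #|A|%:R,
      c' * #|T|%:R <= #|B|%:R \/
        (transitive_set B /\ c' * (tr T)%:R <= #|B|%:R) &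
      density R A B = 1 \/ density R B A = 1].

Definition has_strong_pair (c' : R) chi : Prop :=
  exists A B : {set T}, strong_pair c' chi A B.

End MSequences.

Definition embedding (H T : tournament) (x : H -> T) : Prop :=
  injective x /\ (forall h h' : H, arc (x h) (x h') = arc h h').

Definition embedded (H T : tournament) (m : nat) (v : m.-tuple bool)
    (eta : seq nat) (f : H -> 'I_(long_length v eta)) (chi : mseq T m) : Prop :=
  exists x : H -> T,
    embedding x /\ (forall h : H, x h \in long_set chi (f h)).

Definition well_embedded (R : realType) (H T : tournament) (m : nat)
    (v : m.-tuple bool) (eta : seq nat) (f : H -> 'I_(long_length v eta))
    (mu : R) (chi : mseq T m) : Prop :=
  exists x : H -> T,
    [/\ embedding x,
        (forall h : H, x h \in long_set chi (f h)) &
        (forall i : 'I_(long_length v eta),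
           (forall h : H, x h \notin long_set chi i) ->
           forall h : H,
             ((f h < i)%N ->
                1 - mu <= density R [set x h] (long_set chi i)) /\
             ((i < f h)%N ->
                1 - mu <= density R (long_set chi i) [set x h]))].

(* The host tournament [T] is nonempty: this makes all the sets of an
   m-sequence nonempty, so that their densities are defined. *)
Definition strong_EH (R : realType) (t : nat) (H : 'I_t -> tournament)
    (m : nat) (v : m.-tuple bool) (eta : seq nat)
    (F : forall i, H i -> 'I_(long_length v eta)) : Prop :=
  forall c1 : R, 0 < c1 ->
  exists lambda0 c2 : R, [/\ 0 < lambda0, 0 < c2 &
    forall (T : tournament) (lambda : R) (chi : mseq T m),
      (0 < #|T|)%N -> 0 <= lambda <= lambda0 ->
      is_mseq v eta c1 lambda chi ->
      (exists i : 'I_t, embedded (F i) chi) \/ has_strong_pair c2 chi].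

Definition super_strong_EH (R : realType) (t : nat) (H : 'I_t -> tournament)
    (m : nat) (v : m.-tuple bool) (eta : seq nat)
    (F : forall i, H i -> 'I_(long_length v eta)) : Prop :=
  forall c1 : R, 0 < c1 ->
  exists lambda0 c2 : R, [/\ 0 < lambda0, 0 < c2 &
    forall (T : tournament) (lambda : R) (chi : mseq T m),
      (0 < #|T|)%N -> 0 <= lambda <= lambda0 ->
      is_mseq v eta c1 lambda chi ->
      (exists i : 'I_t,
         well_embedded (F i) ((2 * long_length v eta)%:R^-1 : R) chi) \/
      has_strong_pair c2 chi].

(* Main.v *)
(** Call a vertex of [T_j] an outlier when, for some [i], more than a fraction
    1/(2k) of its arcs to [T_i] point the wrong way. Every [T_j] occupies a
    proportion at least [d = min c1 1] of the [S_i] containing it, so the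
    [T_j]s are pairwise joined forward with density at least
    [1 - lambda / d ^ 2], and by Markov's inequality at most half of each [T_j]
    consists of outliers once [lambda] is small. Removing all outliers leaves a
    [(v, eta, c1 / 2, 4 lambda / d ^ 2)]-m-sequence. A copy of [H_i] in it
    avoids the outliers, so it is well embedded in the original m-sequence, and
    a strong pair in it is one of the original m-sequence. *)

Require Import Defs.
From mathcomp Require Import all_boot all_order all_algebra.
From mathcomp Require Import boolp reals.
From mathcomp Require Import ring lra.
(* Again, because [path.arc] shadows [Defs.arc]. *)
Import Defs.

Set Implicit Arguments.
Unset Strict Implicit.
Unset Printing Implicit Defensive.

Import Order.TTheory GRing.Theory Num.Theory.

(** * Pairwise relations on concatenations, unions, and Markov's inequality *)

Lemma pairwise_flatten (I : Type) (U : Type) (lt : rel I) (r : rel U)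
    (P : I -> seq U) (s : seq I) :
  (forall i, pairwise r (P i)) ->
  (forall i j, lt i j -> allrel r (P i) (P j)) ->
  pairwise lt s -> pairwise r (flatten [seq P i | i <- s]).
Proof.
move=> rP rPP; elim: s => //= i s IHs /andP[lt_is /IHs rs].
rewrite pairwise_cat rP rs !andbT /=.
elim: s lt_is {IHs rs} => [_|j s IHs /= /andP[ij /IHs]]; first exact: allrel0r.
by rewrite allrel_catr rPP.
Qed.

Lemma bigcup_seq_sup (T : finType) (P : seq {set T}) (X : {set T}) :
  X \in P -> X \subset \bigcup_(Y <- P) Y.
Proof. by move=> XP; rewrite (big_rem X) //= subsetUl. Qed.

(** Markov's inequality without division: each selected [x] contributes more than [N] to the sum on
    the right. Used with [a = 2k], [w] counting backward arcs and [N] the size of the opposite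
    set. *)
Lemma card_markov (T : finType) (X : {set T}) (w : T -> nat) (a N : nat) :
  #|[set x in X | N < a * w x]| * N <= a * \sum_(x in X) w x.
Proof.
rewrite -sum_nat_const big_distrr /= [leqRHS](bigID (fun x => N < a * w x)) /=.
apply: leq_trans (leq_addr _ _).
rewrite (eq_bigl (fun x => (x \in X) && (N < a * w x))).
  by apply: leq_sum => x /andP[_ /ltnW].
by move=> x; rewrite inE.
Qed.

(** * Arc counts, densities and transitive sets *)

Section Arcs.

Variable T : tournament.
Implicit Types (X Y : {set T}).

Lemma arcs_betweenE X Y :
  arcs_between X Y = \sum_(x in X) \sum_(y in Y) (arc x y : nat).
Proof.
rewrite /arcs_between -sum1_card pair_big /= big_mkcond [RHS]big_mkcond /=.
by apply: eq_bigr => -[x y] _; rewrite !inE /=;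
   case: (x \in X); case: (y \in Y); case: (arc x y).
Qed.

Lemma arcs_between_sumr X Y :
  \sum_(y in Y) arcs_between X [set y] = arcs_between X Y.
Proof.
rewrite arcs_betweenE exchange_big /=; apply: eq_bigr => y _.
by rewrite arcs_betweenE; apply: eq_bigr => x _; rewrite big_set1.
Qed.

Lemma arcs_between_suml X Y :
  \sum_(x in X) arcs_between [set x] Y = arcs_between X Y.
Proof.
by rewrite arcs_betweenE; apply: eq_bigr => x _; rewrite arcs_betweenE big_set1.
Qed.

Lemma arcs_between_subset X Y X' Y' :
  X' \subset X -> Y' \subset Y -> arcs_between X' Y' <= arcs_between X Y.
Proof.
move=> sX sY; apply: subset_leq_card; apply/subsetP => -[x y].
by rewrite !inE /= => /andP[/andP[/(subsetP sX) -> /(subsetP sY) ->] ->].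
Qed.

Lemma arcs_betweenC X Y : [disjoint X & Y] ->
  arcs_between X Y + arcs_between Y X = #|X| * #|Y|.
Proof.
move=> dXY; rewrite !arcs_betweenE [X in _ + X]exchange_big /= -big_split /=.
rewrite -sum_nat_const; apply: eq_bigr => x xX; rewrite -big_split /= -sum1_card.
apply: eq_bigr => y yY; rewrite arc_total; first by case: (arc y x).
by apply: contraTneq xX => ->; rewrite (disjointFl dXY yY).
Qed.

Lemma complete_to_arcs0 X Y : [disjoint X & Y] -> complete_to X Y ->
  arcs_between Y X = 0.
Proof.
move=> dXY cXY; apply/eqP; rewrite cards_eq0; apply/eqP/setP => -[y x].
rewrite !inE /=; apply/negbTE; apply/negP => /andP[/andP[yY xX]].
rewrite arc_total ?cXY //.
by apply: contraTneq xX => <-; rewrite (disjointFl dXY yY).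
Qed.

Lemma transitive_setS X Y : X \subset Y -> transitive_set Y -> transitive_set X.
Proof.
move=> /subsetP sXY tY p p0 pX; apply: tY => // x /pX; exact: sXY.
Qed.

Lemma transitive_set1 (x : T) : transitive_set [set x].
Proof.
case=> // a p _ /= px; rewrite /ucycle /= => /andP[].
have xE b : b \in a :: p -> b = x by move/px/set1P.
case: p px xE => [|b p] _ xE /=; rewrite (xE a) ?mem_head ?arc_irr //.
by rewrite (xE b) ?inE ?eqxx ?orbT // arc_irr.
Qed.

Lemma leq_tr X : transitive_set X -> #|X| <= tr T.
Proof.
move=> tX; apply: (@leq_bigmax_cond _ _ (fun X : {set T} => #|X|)).
exact/asboolP.
Qed.

Lemma tr_gt0 : 0 < #|T| -> 0 < tr T.
Proof.
by case/card_gt0P=> x _; rewrite -(cards1 x); apply/leq_tr/transitive_set1.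
Qed.

Local Open Scope ring_scope.

(** Counts of backward arcs, unlike densities, are monotone under passing to subsets, so density
    bounds are converted to this form before restricting. *)
Lemma arcs_back_le (R : realType) (l : R) X Y : [disjoint X & Y] ->
  1 - l <= density R X Y -> (arcs_between Y X)%:R <= l * (#|X| * #|Y|)%:R.
Proof.
move=> dXY; have := congr1 (fun n => n%:R : R) (arcs_betweenC dXY).
rewrite /density; case: (posnP (#|X| * #|Y|)%N) => [-> |XY0] /=.
  (* When one set is empty the density is a default value, but there are no arcs either way. *)
  rewrite natrD => E _; rewrite mulr0.
  by have := ler0n R (arcs_between X Y); lra.
by rewrite ler_pdivlMr ?ltr0n // natrD; lra.
Qed.

Lemma density_ge (R : realType) (l : R) X Y : [disjoint X & Y] ->
    (0 < #|X|)%N -> (0 < #|Y|)%N ->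
  (arcs_between Y X)%:R <= l * (#|X| * #|Y|)%:R -> 1 - l <= density R X Y.
Proof.
move=> dXY X0 Y0; have := congr1 (fun n => n%:R : R) (arcs_betweenC dXY).
by rewrite /density ler_pdivlMr ?ltr0n ?muln_gt0 ?X0 // natrD; lra.
Qed.

End Arcs.

(** * Reading [eta] along the ones of [v] *)

Section LongLength.

Variables (m : nat) (v : m.-tuple bool) (eta : seq nat).

Lemma sum_ltnS (P : pred 'I_m) (F : 'I_m -> nat) (n : 'I_m) :
  \sum_(j < m | (j < n.+1) && P j) F j =
  \sum_(j < m | (j < n) && P j) F j + (if P n then F n else 0).
Proof.
case: ifP => Pn.
  rewrite (bigD1 n) /= ?ltnSn ?Pn // addnC; congr (_ + _).
  apply: eq_bigl => j; rewrite ltnS [j < n]ltn_neqAle andbC.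
  by rewrite -(inj_eq val_inj) andbA.
rewrite addn0; apply: eq_bigl => j; rewrite ltnS leq_eqVlt.
by have [/val_inj ->|//] := eqVneq (val j) n; rewrite Pn !andbF.
Qed.

Lemma zetaE n : zeta v n = \sum_(j < m | (j < n) && tnth v j) 1.
Proof. by rewrite /zeta -sum1dep_card. Qed.

Lemma zetaS (i : 'I_m) : zeta v i.+1 = zeta v i + tnth v i.
Proof. by rewrite !zetaE sum_ltnS; case: (tnth v i). Qed.

Lemma zeta_mono a b : a <= b -> zeta v a <= zeta v b.
Proof.
move=> ab; apply: subset_leq_card; apply/subsetP => j; rewrite !inE.
by case/andP=> ja ->; rewrite (leq_trans ja).
Qed.

(** An index [j] with [v(j) = 1] reads entry [zeta v j.+1 - 1 = zeta v j] of [eta], so successive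
    ones read successive entries. *)
Lemma sum_eta_at n : n <= m ->
  \sum_(j < m | (j < n) && tnth v j) eta_at v eta j =
  \sum_(0 <= z < zeta v n) nth 0 eta z.
Proof.
elim: n => [_|n IHn nm].
  by rewrite [LHS]big_pred0 // zetaE [X in index_iota 0 X]big_pred0 // big_geq.
rewrite (sum_ltnS _ _ (Ordinal nm)) /= IHn ?(ltnW nm) //
  (zetaS (Ordinal nm)) /=.
case: ifP => vn; last by rewrite !addn0.
by rewrite addn1 big_nat_recr //= /eta_at (zetaS (Ordinal nm)) vn addn1.
Qed.

Hypothesis size_eta : size eta = zeta v m.

Lemma sum_eta_at_sumn :
  \sum_(j < m | tnth v j) eta_at v eta j = sumn eta.
Proof.
rewrite sumnE (big_nth 0) size_eta -sum_eta_at //.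
by apply: eq_bigl => j; rewrite ltn_ord.
Qed.

Lemma eta_at_gt0 (i : 'I_m) : (forall a, a \in eta -> 0 < a) -> tnth v i ->
  0 < eta_at v eta i.
Proof.
move=> eta0 vi; apply/eta0/mem_nth; rewrite size_eta.
have := zeta_mono (ltn_ord i); rewrite zetaS vi addn1.
exact.
Qed.

End LongLength.

(** * Blocks of the long representation and deletion of a vertex set *)

Definition parts (T : tournament) (m : nat) (v : m.-tuple bool)
    (chi : mseq T m) (i : 'I_m) : seq {set T} :=
  if tnth v i then mparts chi i else [:: mset chi i].

(** Parts are shrunk but never dropped, so positions in the long representation are preserved. *)
Definition mseqD (T : tournament) (m : nat) (chi : mseq T m) (B : {set T}) :=
  MSeq (fun i => mset chi i :\: B)
       (fun i => [seq X :\: B | X <- mparts chi i]).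

Lemma long_repD (T : tournament) (m : nat) (v : m.-tuple bool)
    (chi : mseq T m) (B : {set T}) :
  long_rep v (mseqD chi B) = [seq X :\: B | X <- long_rep v chi].
Proof.
rewrite /long_rep map_flatten -map_comp; congr flatten.
by apply: eq_map => i /=; case: ifP.
Qed.

Lemma long_setD (T : tournament) (m : nat) (v : m.-tuple bool) (eta : seq nat)
    (chi : mseq T m) (B : {set T}) (j : 'I_(long_length v eta)) :
  long_set (mseqD chi B) j = long_set chi j :\: B.
Proof.
rewrite /long_set long_repD.
have [jlt|jge] := ltnP j (size (long_rep v chi)).
  by rewrite (nth_map set0).
by rewrite !nth_default ?size_map // set0D.
Qed.

(** * Sizes of the parts and backward arcs between them *)

Section MSeqTheory.

Local Open Scope ring_scope.

Variables (R : realType) (T : tournament) (m : nat).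
Variables (v : m.-tuple bool) (eta : seq nat).
Hypothesis size_eta : size eta = zeta v m.
Hypothesis eta_gt0 : forall a : nat, a \in eta -> (0 < a)%N.
Hypothesis T_gt0 : (0 < #|T|)%N.
Variables (c lambda : R) (chi : mseq T m).
Hypothesis chiP : is_mseq v eta c lambda chi.

Local Notation k := (long_length v eta).
Local Notation L := (@long_set T m v eta chi).
Let d : R := Num.min c 1.

Let d_gt0 : 0 < d.
Proof. by case: chiP => c0 *; rewrite lt_min c0 ltr01. Qed.

Lemma size_long_rep : size (long_rep v chi) = k.
Proof.
rewrite size_flatten /shape -map_comp sumnE big_map big_enum /=.
rewrite (bigID (fun i => tnth v i)) /= addnC; congr (_ + _)%N.
  rewrite -sum1dep_card; by apply: eq_bigr => i /negbTE /= ->.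
rewrite -(sum_eta_at_sumn size_eta); apply: eq_bigr => i vi; rewrite vi.
by case: chiP => _ _ _ /(_ i); rewrite vi => -[].
Qed.

Lemma part_subset i X : X \in parts v chi i -> X \subset mset chi i.
Proof.
case: chiP => _ _ _ /(_ i) + _; rewrite /parts; case: ifP => _.
  by case=> _ _ <- _ _; exact: bigcup_seq_sup.
by move=> _ /[1!inE] /eqP ->.
Qed.

Lemma part_ge i X : X \in parts v chi i ->
  c * (if tnth v i then (tr T)%:R else #|T|%:R) <= #|X|%:R.
Proof.
case: chiP => _ _ _ /(_ i) + _; rewrite /parts; case: ifP => _.
  by case=> _ _ _ _; exact.
by move=> + /[1!inE] /eqP ->.
Qed.

Lemma part_gt0 i X : X \in parts v chi i -> (0 < #|X|)%N.
Proof.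
move/part_ge; rewrite -(ltr0n R); apply: lt_le_trans.
case: chiP => c0 _ _ _ _; rewrite mulr_gt0 //.
by case: ifP; rewrite ltr0n // tr_gt0.
Qed.

(** The two terms of the minimum [d] serve the two kinds of index: if [v(i) = 1], then [X] has at
    least [c * tr T] vertices while the transitive set [S_i] has at most [tr T]; if [v(i) = 0], then
    [X] is [S_i] itself. *)
Lemma part_large i X : X \in parts v chi i -> d * #|mset chi i|%:R <= #|X|%:R.
Proof.
move=> Xi; case vi: (tnth v i).
  apply: le_trans (part_ge Xi); rewrite vi; apply: ler_pM => //.
  - exact: ltW.
  - by rewrite ge_min lexx.
  - rewrite ler_nat; apply: leq_tr.
    by case: chiP => _ _ _ /(_ i); rewrite vi => -[].
move: Xi; rewrite /parts vi inE => /eqP ->.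
by rewrite ler_piMl // ge_min lexx orbT.
Qed.

Lemma parts_neq0 i : exists X, X \in parts v chi i.
Proof.
case vi: (tnth v i); last by exists (mset chi i); rewrite /parts vi mem_head.
exists (nth set0 (parts v chi i) 0); apply: mem_nth; rewrite /parts vi.
case: chiP => _ _ _ /(_ i); rewrite vi => -[_ -> _ _ _ _].
exact: eta_at_gt0.
Qed.

Let e : R := lambda / d ^+ 2.

Let back_sparse (X Y : {set T}) : bool :=
  [disjoint X & Y] && ((arcs_between Y X)%:R <= e * (#|X| * #|Y|)%:R).

Lemma e_ge0 : 0 <= e.
Proof.
by case: chiP => _ /andP[l0 _] _ _ _; rewrite divr_ge0 // exprn_ge0 // ltW.
Qed.

(** Within one [S_i], completeness leaves no backward arcs. Across [S_i] and [S_j], parts inherit at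
    most [lambda * |S_i| * |S_j|] backward arcs, and each part fills a fraction [d] of its set,
    whence [e = lambda / d ^ 2]. *)
Lemma pairwise_long_rep : pairwise back_sparse (long_rep v chi).
Proof.
apply: (@pairwise_flatten 'I_m _ (fun i j => (i < j)%N) _ (parts v chi)).
- move=> i; rewrite /parts; case: ifP => [vi|_]; last by [].
  case: chiP => _ _ _ /(_ i) + _; rewrite vi => -[_ _ _ pi _].
  apply/(pairwiseP set0) => a b _ bs ab.
  have [|dab cab] := pi a b; first by rewrite ab.
  rewrite /back_sparse dab complete_to_arcs0 //=.
  by rewrite mulr_ge0 // e_ge0.
- move=> i j ij; apply/allrelP => X Y Xi Yj.
  case: chiP => _ /andP[l0 _] dS _ /(_ i j ij).
  have neq_ij : i != j by rewrite neq_ltn ij.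
  have sX := part_subset Xi; have sY := part_subset Yj.
  move/(arcs_back_le (dS _ _ neq_ij)) => H.
  rewrite /back_sparse; apply/andP; split.
    by rewrite (disjointWl sX) // (disjointWr sY) // dS.
  apply: (@le_trans _ _ (arcs_between (mset chi j) (mset chi i))%:R).
    by rewrite ler_nat arcs_between_subset.
  apply: (le_trans H).
  have -> : lambda = e * d ^+ 2 by rewrite /e mulfVK // expf_neq0 // gt_eqF.
  rewrite -mulrA ler_wpM2l ?e_ge0 // !natrM expr2 mulrACA.
  by apply: ler_pM; rewrite ?mulr_ge0 ?(ltW d_gt0) ?part_large.
rewrite -(@pairwise_map _ _ val ltn) val_enum_ord.
by rewrite -(sorted_pairwise ltn_trans) iota_ltn_sorted.
Qed.

Lemma long_set_sparse (i j : 'I_k) : (i < j)%N -> back_sparse (L i) (L j).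
Proof.
move=> ij; move/(pairwiseP set0): pairwise_long_rep; apply => //;
by rewrite inE size_long_rep.
Qed.

Lemma long_set_disjoint (i j : 'I_k) : i != j -> [disjoint L i & L j].
Proof.
rewrite neq_ltn => /orP[/long_set_sparse /andP[]//|].
by rewrite disjoint_sym => /long_set_sparse /andP[].
Qed.

Lemma long_setP X : reflect (exists j : 'I_k, X = L j) (X \in long_rep v chi).
Proof.
apply: (iffP idP) => [|[j ->]]; last by rewrite mem_nth ?size_long_rep.
by move=> /(nthP set0)[j]; rewrite size_long_rep => jk <-; exists (Ordinal jk).
Qed.

Lemma mem_long_rep X :
  reflect (exists i, X \in parts v chi i) (X \in long_rep v chi).
Proof.
apply: (iffP flatten_mapP) => [[i _ Xi]|[i Xi]]; exists i => //.
by rewrite mem_enum.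
Qed.

Lemma long_set_gt0 (j : 'I_k) : (0 < #|L j|)%N.
Proof.
have /mem_long_rep[i /part_gt0//] : L j \in long_rep v chi.
by apply/long_setP; exists j.
Qed.

(* [x \in L j] sends more than a fraction 1/(2k) of the arcs between itself
   and [L i] the wrong way. *)
Definition outliers (j i : 'I_k) : {set T} :=
  if (j < i)%N then
    [set x in L j | (#|L i| < 2 * k * arcs_between (L i) [set x])%N]
  else if (i < j)%N then
    [set x in L j | (#|L i| < 2 * k * arcs_between [set x] (L i))%N]
  else set0.

Lemma outliers_subset j i : outliers j i \subset L j.
Proof.
rewrite /outliers; do 2?[case: ifP => _]; last exact: sub0set;
by apply/subsetP => x; rewrite inE => /andP[].
Qed.

(** Each outlier has more than [|L i| / (2k)] backward arcs with [L i], out of at most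
    [e * |L j| * |L i|] in total; the positive factor [|L i|] then cancels. *)
Lemma card_outliers j i :
  #|outliers j i|%:R <= (2 * k)%:R * e * #|L j|%:R :> R.
Proof.
have Li := long_set_gt0 i.
rewrite -(@ler_pM2r _ #|L i|%:R) ?ltr0n //.
have bound (n : nat) : n%:R <= e * (#|L j| * #|L i|)%:R ->
    (2 * k * n)%:R <= (2 * k)%:R * e * #|L j|%:R * #|L i|%:R :> R.
  move=> H.
  have -> : (2 * k)%:R * e * #|L j|%:R * #|L i|%:R =
      (2 * k)%:R * (e * (#|L j| * #|L i|)%:R) :> R.
    by rewrite (natrM _ #|L j|); ring.
  by rewrite natrM ler_wpM2l.
rewrite -natrM /outliers; case: ifP => [ji|_]; last case: ifP => [ij|_].
- have /andP[_ /bound] := long_set_sparse ji; apply: le_trans.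
  by rewrite ler_nat -arcs_between_sumr card_markov.
- have /andP[_] := long_set_sparse ij; rewrite mulnC => /bound; apply: le_trans.
  by rewrite ler_nat -arcs_between_suml card_markov.
- by rewrite cards0 mul0n mulr0n mulr_ge0 // mulr_ge0 // mulr_ge0 // e_ge0.
Qed.

(** * Deletion of all outliers *)

Definition bad : {set T} := \bigcup_(j < k) \bigcup_(i < k) outliers j i.

(** This gives both [4 k^2 e <= 1], so that outliers fill at most half of each [L j], and [4 e < 1],
    which the new m-sequence requires; [k + 1] secures the latter even for [k = 0]. *)
Hypothesis e_small : 8 * k.+1%:R ^+ 2 * e <= 1.

Lemma good_large j : #|L j|%:R <= 2 * #|L j :\: bad|%:R :> R.
Proof.
(* By disjointness, outliers of another [L j'] do not meet [L j], so only [k] outlier sets count. *)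
have sub : L j :&: bad \subset \bigcup_(i < k) outliers j i.
  apply/subsetP => x /setIP[xj /bigcupP[j' _ /bigcupP[i _ xo]]].
  apply/bigcupP; exists i => //.
  have xj' := subsetP (outliers_subset j' i) _ xo.
  have [<-//|/long_set_disjoint dis] := eqVneq j' j.
  by rewrite (disjointFr dis xj') in xj.
have card_le : (#|L j :&: bad| <= \sum_(i < k) #|outliers j i|)%N.
  apply: leq_trans (subset_leq_card sub) _.
  elim/big_rec2: _ => [|i a A _ le]; first by rewrite cards0.
  by rewrite (leq_trans (leq_card_setU _ _)) // leq_add2l.
have H : #|L j :&: bad|%:R <= k%:R * ((2 * k)%:R * e * #|L j|%:R) :> R.
  apply: (@le_trans _ _ (\sum_(i < k) #|outliers j i|)%:R).
    by rewrite ler_nat.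
  rewrite natr_sum.
  apply: le_trans (ler_sum _ (fun i _ => card_outliers j i)) _.
  by rewrite sumr_const card_ord [leRHS]mulr_natl.
have E : #|L j|%:R = #|L j :&: bad|%:R + #|L j :\: bad|%:R :> R.
  by rewrite -natrD cardsID.
have ke : 2 * (k%:R * ((2 * k)%:R * e)) <= 1 :> R.
  apply: le_trans e_small; rewrite natrM -(natr1 k).
  have := mulr_ge0 (ler0n R k) e_ge0.
  have := mulr_ge0 (ler0n R k) (mulr_ge0 (ler0n R k) e_ge0).
  by have := e_ge0; move: (e) (k%:R : R) => e1 K; lra.
by have := ler_wpM2r (ler0n R #|L j|) ke; move: (e) H => e'; lra.
Qed.

Lemma part_good_large i X : X \in parts v chi i ->
  #|X|%:R <= 2 * #|X :\: bad|%:R :> R.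
Proof.
move=> Xi; have /long_setP[j ->] : X \in long_rep v chi.
  by apply/mem_long_rep; exists i.
exact: good_large.
Qed.

(** A single part suffices: it fills a fraction [d] of [S_i] and keeps half of its vertices. *)
Lemma mset_good_large i : d / 2 * #|mset chi i|%:R <= #|mset chi i :\: bad|%:R.
Proof.
have [X Xi] := parts_neq0 i.
have := part_large Xi; have := part_good_large Xi.
have : #|X :\: bad|%:R <= #|mset chi i :\: bad|%:R :> R.
  by rewrite ler_nat subset_leq_card // setSD // part_subset.
lra.
Qed.

Lemma mset_good_gt0 i : (0 < #|mset chi i :\: bad|)%N.
Proof.
have [X Xi] := parts_neq0 i; rewrite -(ltr0n R).
apply: lt_le_trans (mset_good_large i); rewrite mulr_gt0 ?divr_gt0 // ltr0n.
by rewrite (leq_trans (part_gt0 Xi)) // subset_leq_card // part_subset.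
Qed.

Lemma is_mseq_good : is_mseq v eta (c / 2) (4 * e) (mseqD chi bad).
Proof.
case: chiP => c0 /andP[l0 _] dS partsP dens.
split=> [|||i|i j ij] /=.
- by rewrite divr_gt0.
- rewrite mulr_ge0 ?e_ge0 //=; have := e_small; have := e_ge0.
  rewrite -(natr1 k); have := ler0n R k; move: (k%:R : R) => K K0 e0 H; nra.
- move=> i j /dS; apply: disjointW; exact: subsetDl.
- have good X : X \in parts v chi i ->
      c / 2 * (if tnth v i then (tr T)%:R else #|T|%:R) <= #|X :\: bad|%:R.
    by move=> Xi; have := part_ge Xi; have := part_good_large Xi; lra.
  move: (partsP i) good; rewrite /parts; case: ifP => _; last first.
    by move=> _ /(_ _ (mem_head _ _)).
  case=> tS szS cupS cS _ good; split.
  + exact: transitive_setS (subsetDl _ _) tS.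
  + by rewrite size_map.
  + rewrite big_map -cupS.
    by rewrite (big_morph (fun X => X :\: bad) (fun X Y => setDUl X Y bad)
                          (set0D bad)).
  + rewrite size_map => a b ab; have /andP[ab' bs] := ab.
    have [dab cab] := cS a b ab.
    rewrite !(nth_map set0) ?(ltn_trans ab') //; split.
      by apply: disjointW dab; exact: subsetDl.
    by move=> x y /setDP[xa _] /setDP[yb _]; exact: cab.
  + by move=> _ /mapP[X XS ->]; exact: good.
- have neq_ij : i != j by rewrite neq_ltn ij.
  have H := arcs_back_le (dS _ _ neq_ij) (dens _ _ ij).
  apply: density_ge; rewrite ?mset_good_gt0 //.
    by apply: disjointW (dS _ _ neq_ij); exact: subsetDl.
  apply: (@le_trans _ _ (arcs_between (mset chi j) (mset chi i))%:R).
    by rewrite ler_nat arcs_between_subset ?subsetDl.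
  apply: (le_trans H).
  (* Each of the two sets keeps a fraction [d / 2], which turns [lambda] into [4 e]. *)
  have -> : lambda = 4 * e * (d / 2 * (d / 2)).
    by rewrite /e; field; rewrite gt_eqF.
  rewrite -mulrA; apply: ler_wpM2l; first by rewrite mulr_ge0 // e_ge0.
  rewrite !natrM mulrACA.
  have d2_ge0 : 0 <= d / 2 by rewrite ltW // divr_gt0.
  by apply: ler_pM; rewrite ?mset_good_large ?(mulr_ge0 d2_ge0).
Qed.

(** Failing the outlier inequality is precisely the required density bound, because the set on one
    side is a singleton. *)
Lemma good_density (i j : 'I_k) x : x \in L j :\: bad ->
  ((j < i)%N -> 1 - (2 * k)%:R^-1 <= density R [set x] (L i)) /\
  ((i < j)%N -> 1 - (2 * k)%:R^-1 <= density R (L i) [set x]).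
Proof.
case/setDP=> xj xbad.
have xo : x \notin outliers j i.
  apply: contra xbad => xo; apply/bigcupP; exists j => //.
  by apply/bigcupP; exists i.
(* The index [i] witnesses [k > 0], so the inverse of [2k] is a genuine one. *)
have k2 : (0 < 2 * k)%N by rewrite muln_gt0 (leq_ltn_trans _ (ltn_ord i)).
have bound n : (2 * k * n <= #|L i|)%N ->
    n%:R <= (2 * k)%:R^-1 * #|L i|%:R :> R.
  by move=> le; rewrite ler_pdivlMl ?ltr0n // -natrM ler_nat.
have dis : i != j -> [disjoint L i & [set x]].
  move=> /long_set_disjoint; apply: disjointWr; by rewrite sub1set.
split=> lt; move: xo; rewrite /outliers.
- rewrite lt inE xj -leqNgt => /bound le; apply: density_ge.
  + by rewrite disjoint_sym dis // neq_ltn lt orbT.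
  + by rewrite cards1.
  + exact: long_set_gt0.
  + by rewrite cards1 mul1n.
- rewrite ltnNge (ltnW lt) /= lt inE xj -leqNgt => /bound le; apply: density_ge.
  + by rewrite dis // neq_ltn lt.
  + exact: long_set_gt0.
  + by rewrite cards1.
  + by rewrite cards1 muln1.
Qed.

End MSeqTheory.

(** * Transfer back to the original m-sequence *)

(** The size thresholds refer to [|T|] and [tr T], and the host [T] is unchanged by the deletion, so
    [c] is kept. *)
Lemma has_strong_pairD (R : realType) (T : tournament) (m : nat) (c : R)
    (chi : mseq T m) (B : {set T}) :
  has_strong_pair c (mseqD chi B) -> has_strong_pair c chi.
Proof.
have sub : mvertices (mseqD chi B) \subset mvertices chi.
  apply/bigcupsP => i _.
  by rewrite (subset_trans (subsetDl _ _)) // (bigcup_sup i).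
move=> [X [Y [/and3P[sX sY dXY] *]]]; exists X, Y; split=> //.
by rewrite (subset_trans sX) // (subset_trans sY).
Qed.

Theorem theorem8 (R : realType) (t : nat) (H : 'I_t -> tournament)
    (m : nat) (v : m.-tuple bool) (eta : seq nat)
    (size_eta : size eta = zeta v m)
    (eta_gt0 : forall a : nat, a \in eta -> (0 < a)%N)
    (F : forall i : 'I_t, H i -> 'I_(long_length v eta))
    (F_inj : forall i : 'I_t, injective (F i)) :
  strong_EH R F -> super_strong_EH R F.
Proof.
Local Open Scope ring_scope.
move=> sEH c1 c1_gt0; have c1_half : 0 < c1 / 2 by rewrite divr_gt0.
have [l0 [c2 [l0_gt0 c2_gt0 hEH]]] := sEH _ c1_half.
set d2 : R := Num.min c1 1 ^+ 2.
have d2_gt0 : 0 < d2 by rewrite exprn_gt0 // lt_min c1_gt0 ltr01.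
set K : R := 8 * (long_length v eta).+1%:R ^+ 2.
have K_gt0 : 0 < K by rewrite mulr_gt0 // exprn_gt0 // ltr0n.
(* The first bound on [lambda] makes [4 e] at most [l0], so the hypothesis applies to the reduced
   sequence; the second is the smallness condition [K * e <= 1]. *)
exists (Num.min (l0 / 4 * d2) (K^-1 * d2)), c2; split=> //.
  by rewrite lt_min mulr_gt0 ?divr_gt0 //= mulr_gt0 // invr_gt0.
move=> T lambda chi T_gt0 /andP[l_ge0].
rewrite le_min -![lambda <= _ * d2]ler_pdivrMr //.
case/andP=> l_le l_le' chiP.
have e_small : K * (lambda / d2) <= 1 by rewrite -ler_pdivlMl // mulr1.
have goodP := is_mseq_good size_eta eta_gt0 T_gt0 chiP e_small.
have /(hEH _ _ _ T_gt0)/(_ goodP) : 0 <= 4 * (lambda / d2) <= l0.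
  by rewrite mulr_ge0 ?divr_ge0 ?(ltW d2_gt0) //=; lra.
case=> [[i [x [xemb xin]]]|/has_strong_pairD]; last by right.
have {}xin h : x h \in long_set chi (F i h) :\: bad v eta chi.
  by rewrite -long_setD.
left; exists i, x; split=> // [h|j _ h]; first by case/setDP: (xin h).
exact (good_density size_eta T_gt0 chiP j (xin h)).
Qed.
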